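(* Let $\lambda$ be a partition and let $\Lambda,\Lambda'\in\mathrm{RPP}(\lambda)$ satisfy $g(\Lambda,\Lambda')=0$ ($\Lambda$ is called blue, $\Lambda'$ red). For each $i$, shift the $i$-th blue border strip (with its entries) and the $(i+1)$-th red border strip (with its entries) diagonally by $i$ steps, each step decreasing both the row and the column index by one, and discard the cells that leave the Young diagram; the first red border strip is not moved. Explicitly, define a filling $\Lambda''$ of the cells of $\lambda$ by $$\Lambda''(a,b)=\begin{cases}\Lambda'(a+r-1,\,b+r-1) & \text{if } (a,b) \text{ lies in the } (2r-1)\text{-th border strip of }\lambda,\\ \Lambda(a+r,\,b+r) & \text{if } (a,b)\text{ lies in the } 2r\text{-th border strip of }\lambda,\end{cases}\qquad r\ge1.$$ Then $\Lambda''$ is a valid reverse plane partition of shape $\lambda$.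
   Context: Partitions and RPPs. $\lambda=(\lambda_1\ge\dots\ge\lambda_\ell>0)$ is an integer partition, $\ell=\ell(\lambda)$, $\lambda'$ is the conjugate partition. The cells of $\lambda$ are the pairs $(i,j)$ with $1\le i\le \ell$, $1\le j\le\lambda_i$ ($i$ is the row, numbered from the bottom, $j$ the column). A reverse plane partition (RPP) of shape $\lambda$ is a map $\Lambda$ from the cells of $\lambda$ to the non-negative integers that is weakly increasing in $i$ and weakly increasing in $j$; $\mathrm{RPP}(\lambda)$ is the set of these. Conventions: $\Lambda(i,0)=\Lambda(0,j)=0$. Border strips. The border strips of $\lambda$ are obtained by removing the largest border strip (the whole outer rim) of $\lambda$, then the largest border strip of what remains, and so on; they are ordered from outermost to innermost. Equivalently, the cell $(a,b)$ lies in the $s$-th border strip, where $s=\max\{r\ge1:(a+r-1,b+r-1)\in\lambda\}$. The $s$-th blue (resp. red) border strip is the $s$-th border strip filled with the entries of $\Lambda$ (resp. $\Lambda'$). Shifting the path drawn on the lozenge tiling along a border strip vertically down by one step corresponds to shifting the filled border strip diagonally by one step. Coupled pairs. View an RPP as a stack of $\Lambda(i,j)$ unit cubes over each cell $(i,j)$, in an infinitely tall room whose back wall follows the boundary of $\lambda$, seen from the corner of small $i,j$; this gives a lozenge tiling. A point $(u,v,h)$ ($u$ in the row direction index $i$, $v$ in the column direction index $j$, $h$ height) is projected to horizontal coordinate $v-u$ and vertical coordinate $h+(u+v)/2$. The picture is cut into vertical slices $[d,d+1]$, $d=-\ell,\dots,\lambda_1-1$. A slice $d$ is a hole slice if $d\in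 H=\{j-1-\lambda'_j:1\le j\le\lambda_1\}$ and a particle slice if $d\in D=\{\lambda_i-i:1\le i\le \ell\}$ ($H$ and $D$ partition $\{-\ell,\dots,\lambda_1-1\}$). There are three lozenge types: top faces of stacks; ''left'' faces, separating $(i,j-1)$ from $(i,j)$; ''right'' faces, separating $(i-1,j)$ from $(i,j)$. Recording each lozenge, up to a shift depending only on $d$, by the vertical position of the unit vertical segment at horizontal coordinate $d+1$ (the right edge of a left or right face in slice $d$, or the short diagonal of a top face centred at $d+1$), set - for $d\in H$: $O_d(\Lambda)=\{h+i : (i,j)\in\lambda,\ j-i=d+1,\ h\in\mathbb Z,\ \Lambda(i,j-1)<h\le\Lambda(i,j)\}$ (left faces in slice $d$); - for $d\in D$: $B_d(\Lambda)=\{h+i : (i,j)\in\lambda,\ j-i=d,\ h\in\mathbb Z,\ \Lambda(i-1,j)<h\le\Lambda(i,j)\}$ (right faces in slice $d$); - for all $d$: $T_d(\Lambda)=\{\Lambda(i,j)+i+1 : (i,j)\in\lambda,\ j-i=d+1\}$ (top faces). When the tilings of $\Lambda$ (''blue'') and $\Lambda'$ (''red'') are superimposed, a coupled pair is one of: (type 1) in a hole slice, a blue left face whose right edge is the short diagonal of a red top face; (type 2) in a hole slice, a blue and a red left face in the same position; (type 3) in a particle slice, a blue and a red right face in the same position; (type 4) in a particle slice, a red right face whose right edge is the short diagonal of a blue top face. Then $g(\Lambda,\Lambda')$ is the number of coupled pairs, i.e. $$g(\Lambda,\Lambda')=\sum_{d\in H}\big(|O_d(\Lambda)\cap T_d(\Lambda')|+|O_d(\Lambda)\cap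 O_d(\Lambda')|\big)+\sum_{d\in D}\big(|B_d(\Lambda)\cap B_d(\Lambda')|+|T_d(\Lambda)\cap B_d(\Lambda')|\big).$$ *)

(* Defs.v *)
From mathcomp Require Import all_boot all_order all_algebra.
From mathcomp Require Import finmap.

Set Implicit Arguments.
Unset Strict Implicit.
Unset Printing Implicit Defensive.

Local Open Scope fset_scope.
Local Open Scope nat_scope.

Definition is_partition (lam : seq nat) : bool :=
  sorted geq lam && all (leq 1) lam.

(* Rows and columns are numbered from 1, hence the shift of index. *)
Definition part (lam : seq nat) (i : nat) : nat := nth 0 lam i.-1.

Definition conj_part (lam : seq nat) (j : nat) : nat := count (leq j) lam.

Definition cells (lam : seq nat) : seq (nat * nat) :=
  [seq (i, j) | i <- iota 1 (size lam), j <- iota 1 (part lam i)].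

(* Only the values at the cells of the shape are meaningful. *)
Definition filling := nat -> nat -> nat.

Definition is_rpp (lam : seq nat) (L : filling) : Prop :=
  (forall i i' j, (i, j) \in cells lam -> (i', j) \in cells lam ->
     i <= i' -> L i j <= L i' j) /\
  (forall i j j', (i, j) \in cells lam -> (i, j') \in cells lam ->
     j <= j' -> L i j <= L i j').

(* The convention L(i,0) = L(0,j) = 0. *)
Definition bval (L : filling) (i j : nat) : nat :=
  if (i == 0) || (j == 0) then 0 else L i j.

Definition diagonal (lam : seq nat) (d : int) : seq (nat * nat) :=
  [seq c <- cells lam | (c.2%:Z - c.1%:Z == d)%R].

Definition hole_slices (lam : seq nat) : {fset int} :=
  [fset x in [seq (j%:Z - 1 - (conj_part lam j)%:Z)%R | j <- iota 1 (part lam 1)]].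

Definition particle_slices (lam : seq nat) : {fset int} :=
  [fset x in [seq ((part lam i)%:Z - i%:Z)%R | i <- iota 1 (size lam)]].

(* [index_iota m.+1 n.+1] enumerates the integers h with m < h <= n; such h
   are positive, so heights and positions can be taken in nat. *)
Definition left_faces (lam : seq nat) (L : filling) (d : int) : {fset nat} :=
  [fset x in [seq h + c.1 | c <- diagonal lam (d + 1)%R,
                            h <- index_iota (bval L c.1 c.2.-1).+1 (L c.1 c.2).+1]].

Definition right_faces (lam : seq nat) (L : filling) (d : int) : {fset nat} :=
  [fset x in [seq h + c.1 | c <- diagonal lam d,
                            h <- index_iota (bval L c.1.-1 c.2).+1 (L c.1 c.2).+1]].

Definition top_faces (lam : seq nat) (L : filling) (d : int) : {fset nat} :=
  [fset x in [seq L c.1 c.2 + c.1 + 1 | c <- diagonal lam (d + 1)%R]].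

(* [L] is the blue filling, [L'] the red one. *)
Definition coupled_pairs (lam : seq nat) (L L' : filling) : nat :=
  \sum_(d <- hole_slices lam)
     (#|` left_faces lam L d `&` top_faces lam L' d |
      + #|` left_faces lam L d `&` left_faces lam L' d |)
  + \sum_(d <- particle_slices lam)
     (#|` right_faces lam L d `&` right_faces lam L' d |
      + #|` top_faces lam L d `&` right_faces lam L' d |).

(* The index, counted from the outermost, of the border strip containing the
   cell (a,b); it is 0 when (a,b) is not a cell.  The bound on r loses nothing,
   since a + r - 1 is a row of lam and a >= 1. *)
Definition strip_index (lam : seq nat) (a b : nat) : nat :=
  \max_(1 <= r < (size lam).+1 | (a + r - 1, b + r - 1) \in cells lam) r.

(* Both s = 2r - 1 and s = 2r give r = uphalf s. *)
Definition shift_strips (lam : seq nat) (L L' : filling) : filling :=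
  fun a b =>
    let s := strip_index lam a b in
    let r := uphalf s in
    if odd s then L' (a + r - 1) (b + r - 1) else L (a + r) (b + r).

(* Main.v *)
Require Import Defs.
From mathcomp Require Import all_boot all_order all_algebra.
From mathcomp Require Import finmap zify.

Set Implicit Arguments.
Unset Strict Implicit.
Unset Printing Implicit Defensive.

Local Open Scope fset_scope.
Local Open Scope nat_scope.

(** Along a diagonal, listed from the outermost cell inwards, the entries of
the shifted filling are L'_1, L_1, L'_2, L_2, ..., where L_s and L'_s are the
blue and red entries in the s-th border strip.  If no pair is coupled, then
L i j <= L' i j on every cell, by induction on the content from left to right,
and L' i j <= L (i+1) (j+1), by induction from right to left.  Crossing a slice,
each of these inequalities comes out in a sharper form comparing entries on two
adjacent diagonals; the sharper forms are the interlacing conditions of the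
shifted filling that are not already conditions on L or L' alone. *)

(** * Cells, border strips and slices of a partition shape *)

Section Shape.

Variable lam : seq nat.

Lemma mem_cells i j :
  ((i, j) \in cells lam) = [&& 0 < i, i <= size lam, 0 < j & j <= part lam i].
Proof.
apply/allpairsPdep/idP => [[a [b [+ + [-> ->]]]]|H].
  by rewrite !mem_iota; lia.
by exists i, j; split; rewrite // mem_iota; lia.
Qed.

Lemma mem_diagonal i j d :
  ((i, j) \in diagonal lam d) =
  ((j%:Z - i%:Z)%R == d) && ((i, j) \in cells lam).
Proof. by rewrite mem_filter. Qed.

(** This rule and the next two go one way: every contradiction below comes from exhibiting a
    position shared by a blue and a red face. *)
Lemma mem_left_faces L d i j x : (i, j) \in cells lam ->
  d = (j%:Z - i%:Z - 1)%R -> bval L i j.-1 + i < x <= L i j + i ->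
  x \in left_faces lam L d.
Proof.
move=> cij -> hx; rewrite inE /=; apply/allpairsPdep.
exists (i, j), (x - i); rewrite mem_diagonal cij mem_index_iota /=.
by split; lia.
Qed.

Lemma mem_right_faces L d i j x : (i, j) \in cells lam ->
  d = (j%:Z - i%:Z)%R -> bval L i.-1 j + i < x <= L i j + i ->
  x \in right_faces lam L d.
Proof.
move=> cij -> hx; rewrite inE /=; apply/allpairsPdep.
exists (i, j), (x - i); rewrite mem_diagonal cij mem_index_iota /=.
by split; lia.
Qed.

Lemma mem_top_faces L d i j x : (i, j) \in cells lam ->
  d = (j%:Z - i%:Z - 1)%R -> x = L i j + i + 1 -> x \in top_faces lam L d.
Proof.
move=> cij -> ->; rewrite inE /=; apply/mapP; exists (i, j) => //.
by rewrite mem_diagonal cij; lia.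
Qed.

Hypothesis hlam : is_partition lam.

Lemma part_anti i i' : 0 < i -> i <= i' -> i' <= size lam ->
  part lam i' <= part lam i.
Proof.
move=> i0 ii' i'n; have /andP[srt _] := hlam; rewrite /part.
have tr : transitive geq by move=> x y z /= h1 h2; lia.
have rf : reflexive geq by move=> x /=; apply: leqnn.
by apply: (sorted_leq_nth tr rf 0 srt); rewrite ?unfold_in /=; lia.
Qed.

Lemma cells_down i j i' j' : (i, j) \in cells lam ->
  0 < i' <= i -> 0 < j' <= j -> (i', j') \in cells lam.
Proof.
rewrite !mem_cells => /and4P[i0 il j0 jl] hi hj.
by have := @part_anti i' i; lia.
Qed.

(** The count splits at row [i]: the first [i] rows reach column [j], and a later row reaching it
    would force [(i.+1, j)] into the shape. *)
Lemma conj_part_corner i j : (i, j) \in cells lam ->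
  (i.+1, j) \notin cells lam -> conj_part lam j = i.
Proof.
move=> cij ncij; have:= cij; rewrite mem_cells => /and4P[i0 il j0 jl].
rewrite /conj_part -[lam](cat_take_drop i) count_cat.
have -> : count (leq j) (take i lam) = i.
  apply: etrans (_ : size (take i lam) = i); last by rewrite size_takel.
  apply/eqP; rewrite -all_count; apply/(all_nthP 0) => k.
  rewrite size_takel // => kl; rewrite nth_take //.
  by have := @cells_down i j k.+1 j cij; rewrite mem_cells /part /=; lia.
rewrite (_ : count _ (drop i lam) = 0) ?addn0 //.
apply/eqP; rewrite -leqn0 leqNgt -has_count; apply/(has_nthP 0) => -[k].
rewrite size_drop nth_drop => kl jk; move/negP: ncij; apply.
apply: (@cells_down (i + k).+1 j); last by lia.
  by rewrite mem_cells /part /=; lia.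
by lia.
Qed.

(** A diagonal that leaves the shape never returns to it, so [s] is the maximum. *)
Lemma strip_index_eq a b s : 0 < a -> 0 < b -> 0 < s ->
  (a + s - 1, b + s - 1) \in cells lam -> (a + s, b + s) \notin cells lam ->
  strip_index lam a b = s.
Proof.
move=> a0 b0 s0 cs ncs; rewrite /strip_index.
apply/eqP; rewrite eqn_leq; apply/andP; split.
  apply/bigmax_leqP_seq => r; rewrite mem_index_iota => hr cr.
  rewrite leqNgt; apply/negP => sr; case/negP: ncs.
  by apply: cells_down cr _ _; lia.
apply: (@leq_bigmax_seq _ _ _ id) => //.
by rewrite mem_index_iota; move: cs; rewrite mem_cells; lia.
Qed.

Lemma strip_indexP a b : (a, b) \in cells lam ->
  exists2 s, 0 < s &
    [/\ strip_index lam a b = s, (a + s - 1, b + s - 1) \in cells lam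
      & (a + s, b + s) \notin cells lam].
Proof.
move=> cab; have := cab; rewrite mem_cells => /and4P[a0 al b0 bl].
have ex : exists s, (a + s, b + s) \notin cells lam.
  (* Row [a + size lam] lies beyond the last row, because [a] is positive. *)
  by exists (size lam); rewrite mem_cells; lia.
case: (ex_minnP ex) => s ns smin.
have s0 : 0 < s by case: s ns {smin} => // ; rewrite !addn0 cab.
have cs : (a + s - 1, b + s - 1) \in cells lam.
  apply/negPn/negP => h; have := smin s.-1.
  have -> : a + s.-1 = a + s - 1 by lia.
  have -> : b + s.-1 = b + s - 1 by lia.
  by move=> /(_ h); lia.
by exists s => //; split=> //; apply: strip_index_eq.
Qed.

Lemma hole_slice i j : (i, j) \in cells lam -> (i.+1, j) \notin cells lam ->
  (j%:Z - i%:Z - 1)%R \in hole_slices lam.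
Proof.
move=> cij ncij; rewrite inE /=; apply/mapP; exists j.
  have := @cells_down i j 1 j cij; rewrite mem_iota.
  by move: cij; rewrite !mem_cells; lia.
by rewrite (conj_part_corner cij ncij); lia.
Qed.

Lemma particle_slice i j : (i, j) \in cells lam -> (i, j.+1) \notin cells lam ->
  (j%:Z - i%:Z)%R \in particle_slices lam.
Proof.
rewrite !mem_cells => cij ncij; rewrite inE /=; apply/mapP; exists i.
  by rewrite mem_iota; lia.
by have -> : part lam i = j by lia.
Qed.

(** A slice depends only on the content, so it can be read off at the outermost cell of the
    diagonal, which here tops its column. *)
Lemma left_slice_hole i j s : 0 < s ->
  (i + s - 1, j + s - 1) \in cells lam -> (i + s, j + s - 1) \notin cells lam ->
  (j%:Z - i%:Z - 1)%R \in hole_slices lam.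
Proof.
move=> s0 c n; suff -> : (j%:Z - i%:Z - 1 =
    (j + s - 1)%N%:Z - (i + s - 1)%N%:Z - 1)%R.
  by apply: hole_slice => //; have -> : (i + s - 1).+1 = i + s by lia.
by lia.
Qed.

Lemma right_slice_particle i j s : 0 < s ->
  (i + s - 1, j + s - 1) \in cells lam -> (i + s - 1, j + s) \notin cells lam ->
  (j%:Z - i%:Z)%R \in particle_slices lam.
Proof.
move=> s0 c n; suff -> : (j%:Z - i%:Z =
    (j + s - 1)%N%:Z - (i + s - 1)%N%:Z)%R.
  by apply: particle_slice => //; have -> : (j + s - 1).+1 = j + s by lia.
by lia.
Qed.

(** The outermost cell of the diagonal either tops its column, or has above it a cell that ends its
    row and makes the slice a particle slice. *)
Lemma left_sliceP i j : (i, j) \in cells lam ->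
  (j%:Z - i%:Z - 1)%R \in hole_slices lam \/
  (j%:Z - i%:Z - 1)%R \in particle_slices lam /\ (i.+1, j) \in cells lam.
Proof.
move=> cij; have [s s0 [_ cs ns]] := strip_indexP cij.
have [c|n] := boolP ((i + s, j + s - 1) \in cells lam); last first.
  by left; apply: left_slice_hole n.
right; split; last by apply: (cells_down c); move: cij; rewrite mem_cells; lia.
have -> : (j%:Z - i%:Z - 1 = j%:Z - i.+1%:Z)%R by lia.
by apply: (@right_slice_particle _ _ s); rewrite // addSn subSS subn0.
Qed.

Lemma right_sliceP i j : (i, j) \in cells lam ->
  (j%:Z - i%:Z)%R \in particle_slices lam \/
  (j%:Z - i%:Z)%R \in hole_slices lam /\ (i, j.+1) \in cells lam.
Proof.
move=> cij; have [s s0 [_ cs ns]] := strip_indexP cij.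
have [c|n] := boolP ((i + s - 1, j + s) \in cells lam); last first.
  by left; apply: right_slice_particle n.
right; split; last by apply: (cells_down c); move: cij; rewrite mem_cells; lia.
have -> : (j%:Z - i%:Z = j.+1%:Z - i%:Z - 1)%R by lia.
by apply: (@left_slice_hole _ _ s); rewrite // addSn subSS subn0.
Qed.

Lemma is_rpp_of_steps (M : filling) :
  (forall i j, (i, j) \in cells lam -> (i.+1, j) \in cells lam ->
     M i j <= M i.+1 j) ->
  (forall i j, (i, j) \in cells lam -> (i, j.+1) \in cells lam ->
     M i j <= M i j.+1) ->
  is_rpp lam M.
Proof.
move=> hr hc; split.
- move=> i i' j cij ci'j /subnKC ii'; move: ci'j; rewrite -ii'.
  elim: (i' - i) => [|k IH]; rewrite ?addn0 //.
  rewrite addnS => c; have c' : (i + k, j) \in cells lam.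
    by apply: (cells_down c); move: cij; rewrite mem_cells; lia.
  exact: leq_trans (IH c') (hr _ _ c' c).
- move=> i j j' cij cij' /subnKC jj'; move: cij'; rewrite -jj'.
  elim: (j' - j) => [|k IH]; rewrite ?addn0 //.
  rewrite addnS => c; have c' : (i, j + k) \in cells lam.
    by apply: (cells_down c); move: cij; rewrite mem_cells; lia.
  exact: leq_trans (IH c') (hc _ _ c' c).
Qed.

End Shape.

(** * Inequalities forced by the absence of coupled pairs *)

Section NoCoupledPair.

Variables (lam : seq nat) (L L' : filling).
Hypothesis hlam : is_partition lam.
Hypothesis hL : is_rpp lam L.
Hypothesis hL' : is_rpp lam L'.
Hypothesis hg : coupled_pairs lam L L' = 0.

Lemma card_fsetI_eq0 (A B : {fset nat}) x :
  #|` A `&` B| = 0 -> x \in A -> x \in B -> False.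
Proof.
move=> /cardfs0_eq AB xA xB.
by have : x \in A `&` B; [rewrite inE xA | rewrite AB inE].
Qed.

Lemma hole_uncoupled d x : d \in hole_slices lam -> x \in left_faces lam L d ->
  x \notin top_faces lam L' d /\ x \notin left_faces lam L' d.
Proof.
move=> dH xO; move/eqP: hg; rewrite addn_eq0 => /andP[+ _].
rewrite sum_nat_seq_eq0 => /allP/(_ d dH) /=.
rewrite addn_eq0 => /andP[/eqP h1 /eqP h2].
by split; apply/negP; [apply: card_fsetI_eq0 h1 xO | apply: card_fsetI_eq0 h2 xO].
Qed.

Lemma particle_uncoupled d x : d \in particle_slices lam ->
  x \in right_faces lam L' d ->
  x \notin right_faces lam L d /\ x \notin top_faces lam L d.
Proof.
move=> dD xB; move/eqP: hg; rewrite addn_eq0 => /andP[_].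
rewrite sum_nat_seq_eq0 => /allP/(_ d dD) /=.
rewrite addn_eq0 => /andP[/eqP h1 /eqP h2].
by split; apply/negP => xA; [apply: card_fsetI_eq0 h1 xA xB
  | apply: card_fsetI_eq0 h2 xA xB].
Qed.

Lemma bval_row_le (M : filling) i j : is_rpp lam M -> (i, j) \in cells lam ->
  bval M i j.-1 <= M i j.
Proof.
move=> [_ hM] c; rewrite /bval; case: ifP => // z.
by apply: hM; rewrite ?leq_pred //; apply: (cells_down hlam c);
  move: c z; rewrite mem_cells; lia.
Qed.

Lemma bval_col_le (M : filling) i j : is_rpp lam M -> (i, j) \in cells lam ->
  bval M i.-1 j <= M i j.
Proof.
move=> [hM _] c; rewrite /bval; case: ifP => // z.
by apply: hM; rewrite ?leq_pred //; apply: (cells_down hlam c);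
  move: c z; rewrite mem_cells; lia.
Qed.

(** If the bound failed, the first position above [bval L' i j.-1] would be a blue left face. Red
    has there a top face if its entry does not rise from column [j.-1] to [j], and a left face
    otherwise; both are coupled. *)
Lemma hole_blue_le_red i j : (i, j) \in cells lam ->
  (j%:Z - i%:Z - 1)%R \in hole_slices lam ->
  bval L i j.-1 <= bval L' i j.-1 -> L i j <= bval L' i j.-1.
Proof.
move=> c dH le; rewrite leqNgt; apply/negP => lt.
have xO : bval L' i j.-1 + i + 1 \in left_faces lam L (j%:Z - i%:Z - 1)%R.
  by apply: (mem_left_faces c) => //; lia.
have [nT nO] := hole_uncoupled dH xO.
have := bval_row_le hL' c; rewrite leq_eqVlt => /orP[/eqP e|lt'].
  by case/negP: nT; apply: (mem_top_faces c) => //; rewrite e.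
by case/negP: nO; apply: (mem_left_faces c) => //; lia.
Qed.

(** A failure would make [L i j + i] a red right face. Blue has there a right face of [(i, j)] or,
    if its entry does not rise from row [i.-1], the top face of [(i.-1, j)]. *)
Lemma particle_blue_le_red i j : (i, j) \in cells lam ->
  (j%:Z - i%:Z)%R \in particle_slices lam ->
  L i j <= L' i j -> L i j <= bval L' i.-1 j.
Proof.
move=> c dD le; rewrite leqNgt; apply/negP => lt.
have xB : L i j + i \in right_faces lam L' (j%:Z - i%:Z)%R.
  by apply: (mem_right_faces c) => //; lia.
have [nB nT] := particle_uncoupled dD xB.
have := bval_col_le hL c; rewrite leq_eqVlt => /orP[/eqP e|lt'].
  (* In row 1 the equality [e] would make [L i j] zero, against [lt]. *)
  have i1 : 1 < i.
    case: (i) c e lt => [|[|k]] //; first by rewrite mem_cells.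
    by rewrite /bval /=; lia.
  have c' : (i.-1, j) \in cells lam.
    by apply: (cells_down hlam c); move: c; rewrite mem_cells; lia.
  case/negP: nT; apply: (mem_top_faces c'); first by lia.
    rewrite -e /bval; case: ifP; last by lia.
  by move: c; rewrite mem_cells; lia.
by case/negP: nB; apply: (mem_right_faces c) => //; lia.
Qed.

(** The position tested is the blue top face of [(i, j.+1)]; a failure would put a red right face of
    [(i, j)] there. *)
Lemma particle_red_le_blue i j :
  (i, j) \in cells lam -> (i, j.+1) \in cells lam ->
  (j%:Z - i%:Z)%R \in particle_slices lam ->
  bval L' i.-1 j <= L i j.+1 -> L' i j <= L i j.+1.
Proof.
move=> c c' dD le; rewrite leqNgt; apply/negP => lt.
have xB : L i j.+1 + i + 1 \in right_faces lam L' (j%:Z - i%:Z)%R.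
  by apply: (mem_right_faces c) => //; lia.
have [_ /negP[]] := particle_uncoupled dD xB.
by apply: (mem_top_faces c') => //; lia.
Qed.

(** The position tested is the red top face of [(i, j)]; a failure would put a blue left face of
    [(i.+1, j.+1)] there, whose higher row absorbs the extra 1 of a top face. *)
Lemma hole_red_le_blue i j :
  (i, j) \in cells lam -> (i.+1, j.+1) \in cells lam ->
  (j%:Z - i%:Z - 1)%R \in hole_slices lam ->
  L' i j <= L i.+1 j.+1 -> L' i j <= L i.+1 j.
Proof.
move=> c c' dH le; rewrite leqNgt; apply/negP => lt.
have xO : L' i j + i + 1 \in left_faces lam L (j%:Z - i%:Z - 1)%R.
  apply: (mem_left_faces c'); first by lia.
  rewrite /bval /=; case: ifP; last by lia.
  by move: c; rewrite mem_cells; lia.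
have [/negP nT _] := hole_uncoupled dH xO; apply: nT.
by apply: (mem_top_faces c).
Qed.

(** The measure grows with the content. A hole slice gives [L i j <= bval L' i j.-1 <= L' i j], a
    particle slice [L i j <= L i.+1 j <= L' i j]. *)
Lemma blue_le_red i j : (i, j) \in cells lam -> L i j <= L' i j.
Proof.
have [n] := ubnP (j + (size lam - i)); elim: n i j => // n IH i j hn c.
have := c; rewrite mem_cells => /and4P[i0 il j0 jl].
have [dH|[dD c']] := left_sliceP hlam c.
  apply: leq_trans (bval_row_le hL' c); apply: hole_blue_le_red => //.
  (* In column 1 both sides are zero by convention. *)
  rewrite /bval; case: ifP => // z; apply: IH; first by lia.
  by apply: (cells_down hlam c); lia.
apply: leq_trans (_ : L i.+1 j <= _); first exact: hL.1.
have -> : L' i j = bval L' i.+1.-1 j.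
  by rewrite /bval; case: ifP => //; lia.
apply: particle_blue_le_red => //.
  by have -> : (j%:Z - i.+1%:Z = j%:Z - i%:Z - 1)%R by lia.
by apply: IH => //; move: c'; rewrite mem_cells; lia.
Qed.

(** The measure drops as the content grows. A particle slice gives
    [L' i j <= L i j.+1 <= L i.+1 j.+1], by induction at [(i.-1, j)]; a hole slice gives
    [L' i j <= L' i j.+1 <= L i.+1 j.+1], by induction at [(i, j.+1)]. *)
Lemma red_le_blue_diag i j : (i, j) \in cells lam ->
  (i.+1, j.+1) \in cells lam -> L' i j <= L i.+1 j.+1.
Proof.
have [n] := ubnP (i + (part lam 1 - j)); elim: n i j => // n IH i j hn c c1.
have := c; rewrite mem_cells => /and4P[i0 il j0 jl].
have ds : (j.+1%:Z - i.+1%:Z = j%:Z - i%:Z)%R by lia.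
have [|[]] := right_sliceP hlam c1; rewrite ds.
  move=> dD; have c' : (i, j.+1) \in cells lam by apply: (cells_down hlam c1); lia.
  apply: leq_trans (_ : L i j.+1 <= _); last by apply: hL.1.
  apply: particle_red_le_blue => //.
  rewrite /bval; case: ifP => // z.
  have -> : L i j.+1 = L i.-1.+1 j.+1 by rewrite prednK.
  apply: IH; rewrite ?prednK //; first by lia.
  by apply: (cells_down hlam c); lia.
move=> dH c2; have c' : (i, j.+1) \in cells lam by apply: (cells_down hlam c1); lia.
apply: leq_trans (_ : L' i j.+1 <= _); first by apply: hL'.2.
apply: hole_red_le_blue => //.
  by have -> : (j.+1%:Z - i%:Z - 1 = j%:Z - i%:Z)%R by lia.
apply: IH => //.
have := part_anti hlam (isT : 0 < 1) i0 il.
by move: c'; rewrite mem_cells; lia.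
Qed.

(* In a hole slice the cell above (a, b) lies in the preceding strip, in a
   particle slice it lies in the same one; for the cell to the right of (a, b)
   it is the other way round. *)
Lemma shift_strips_col a b : (a, b) \in cells lam -> (a.+1, b) \in cells lam ->
  shift_strips lam L L' a b <= shift_strips lam L L' a.+1 b.
Proof.
move=> c c1; have := c; rewrite mem_cells => /and4P[a0 al b0 bl].
have [s s0 [es cs ns]] := strip_indexP hlam c.
have [h|h] := boolP ((a + s, b + s - 1) \in cells lam).
  have es1 : strip_index lam a.+1 b = s.
    apply: strip_index_eq => //; first by rewrite addSn subSS subn0.
    by apply: contra ns => k; apply: (cells_down hlam k); lia.
  rewrite /shift_strips es es1; case: ifP => so.
    by apply: hL'.1; [apply: (cells_down hlam cs)|apply: (cells_down hlam h)|];
      lia.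
  by apply: hL.1; [apply: (cells_down hlam cs)|apply: (cells_down hlam h)|]; lia.
have dH := left_slice_hole hlam s0 cs h.
have s1 : 1 < s.
  case: s s0 {es cs ns dH} h => [|[|s]] // _.
  by rewrite addnK addn1 c1.
have es1 : strip_index lam a.+1 b = s.-1.
  apply: strip_index_eq => //; first by lia.
    by apply: (cells_down hlam cs); lia.
  by apply: contra h => k; apply: (cells_down hlam k); lia.
(* The indices [s] and [s.-1] differ in parity, so the two cells take different colours. With
   [r = uphalf s], odd [s] requires [L' (a + r - 1) (b + r - 1) <= L (a + r) (b + r - 1)], and even
   [s] requires [L (a + r) (b + r) <= L' (a + r) (b + r - 1)]. *)
rewrite /shift_strips es es1; case: ifP => so.
  have -> : odd s.-1 = false by lia.
  set r := uphalf s; have -> : uphalf s.-1 = r.-1 by lia.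
  have -> : a.+1 + r.-1 = (a + r - 1).+1 by lia.
  have -> : b + r.-1 = b + r - 1 by lia.
  have k1 : (a + r - 1, b + r - 1) \in cells lam by apply: (cells_down hlam cs); lia.
  (* Since [s] is odd and exceeds 1, [r < s]. *)
  have k2 : ((a + r - 1).+1, (b + r - 1).+1) \in cells lam.
    by apply: (cells_down hlam cs); lia.
  apply: hole_red_le_blue => //; last exact: red_le_blue_diag.
  by have -> : ((b + r - 1)%N%:Z - (a + r - 1)%N%:Z - 1 = b%:Z - a%:Z - 1)%R by lia.
have -> : odd s.-1 by lia.
set r := uphalf s; have -> : uphalf s.-1 = r by lia.
have k1 : (a + r, b + r) \in cells lam by apply: (cells_down hlam cs); lia.
have k2 : (a + r, b + r - 1) \in cells lam by apply: (cells_down hlam cs); lia.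
have bv (M : filling) : bval M (a + r) (b + r).-1 = M (a + r) (b + r - 1).
  by rewrite /bval -subn1; case: ifP => //; lia.
have -> : a.+1 + r - 1 = a + r by lia.
rewrite -bv; apply: hole_blue_le_red => //; last by rewrite !bv blue_le_red.
by have -> : ((b + r)%N%:Z - (a + r)%N%:Z - 1 = b%:Z - a%:Z - 1)%R by lia.
Qed.

Lemma shift_strips_row a b : (a, b) \in cells lam -> (a, b.+1) \in cells lam ->
  shift_strips lam L L' a b <= shift_strips lam L L' a b.+1.
Proof.
move=> c c1; have := c; rewrite mem_cells => /and4P[a0 al b0 bl].
have [s s0 [es cs ns]] := strip_indexP hlam c.
have [h|h] := boolP ((a + s - 1, b + s) \in cells lam).
  have es1 : strip_index lam a b.+1 = s.
    apply: strip_index_eq => //; first by rewrite addSn subSS subn0.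
    by apply: contra ns => k; apply: (cells_down hlam k); lia.
  rewrite /shift_strips es es1; case: ifP => so.
    by apply: hL'.2; [apply: (cells_down hlam cs)|apply: (cells_down hlam h)|];
      lia.
  by apply: hL.2; [apply: (cells_down hlam cs)|apply: (cells_down hlam h)|]; lia.
have dD := right_slice_particle hlam s0 cs h.
have s1 : 1 < s.
  case: s s0 {es cs ns dD} h => [|[|s]] // _.
  by rewrite addnK addn1 c1.
have es1 : strip_index lam a b.+1 = s.-1.
  apply: strip_index_eq => //; first by lia.
    by apply: (cells_down hlam cs); lia.
  by apply: contra h => k; apply: (cells_down hlam k); lia.
(* The colours differ again: odd [s] requires [L' (a + r - 1) (b + r - 1) <= L (a + r - 1) (b + r)],
   and even [s] requires [L (a + r) (b + r) <= L' (a + r - 1) (b + r)]. *)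
rewrite /shift_strips es es1; case: ifP => so.
  have -> : odd s.-1 = false by lia.
  set r := uphalf s; have -> : uphalf s.-1 = r.-1 by lia.
  have -> : b.+1 + r.-1 = (b + r - 1).+1 by lia.
  have -> : a + r.-1 = a + r - 1 by lia.
  have k1 : (a + r - 1, b + r - 1) \in cells lam by apply: (cells_down hlam cs); lia.
  have k2 : (a + r - 1, (b + r - 1).+1) \in cells lam.
    by apply: (cells_down hlam cs); lia.
  apply: particle_red_le_blue => //.
    by have -> : ((b + r - 1)%N%:Z - (a + r - 1)%N%:Z = b%:Z - a%:Z)%R by lia.
  (* The left side is 0 in row 0; otherwise this is the diagonal inequality at the cell just below
     [(a + r - 1, b + r - 1)]. *)
  rewrite /bval; case: ifP => // z.
  have -> : L (a + r - 1) (b + r - 1).+1 = L (a + r - 1).-1.+1 (b + r - 1).+1.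
    by rewrite prednK //; lia.
  by apply: red_le_blue_diag; apply: (cells_down hlam cs); lia.
have -> : odd s.-1 by lia.
set r := uphalf s; have -> : uphalf s.-1 = r by lia.
have k1 : (a + r, b + r) \in cells lam by apply: (cells_down hlam cs); lia.
have -> : L' (a + r - 1) (b.+1 + r - 1) = bval L' (a + r).-1 (b + r).
  have -> : b.+1 + r - 1 = b + r by lia.
  by rewrite /bval -subn1; case: ifP => //; lia.
apply: particle_blue_le_red => //; last by rewrite blue_le_red.
by have -> : ((b + r)%N%:Z - (a + r)%N%:Z = b%:Z - a%:Z)%R by lia.
Qed.

End NoCoupledPair.

Theorem proposition5p4 (lam : seq nat) (L L' : filling)
  (hlam : is_partition lam) (hL : is_rpp lam L) (hL' : is_rpp lam L')
  (hg : coupled_pairs lam L L' = 0) :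
  is_rpp lam (shift_strips lam L L').
Proof.
apply: is_rpp_of_steps => // a b.
  exact: shift_strips_col.
exact: shift_strips_row.
Qed.
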